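(* Let $q>0$, let $\mathcal U=U_q(\mathfrak g_c)$ be the compact form of the quantum enveloping algebra of a complex simple Lie algebra of rank $n$, let $\rho$ be a unitary representation of $\mathcal U$ on a pre-Hilbert space $D$, let $\Omega\in D$, and let $(j_{st})_{0\le s\le t}$ be a Lévy process on $\mathcal U$ (with values in a $*$-algebra $\mathcal A$ with state $\Phi$) with generator $\psi(u)=\langle\Omega,(\rho(u)-\varepsilon(u))\Omega\rangle$. Write $\Omega=\sum_{\lambda\in\Lambda_\Omega}v_\lambda$ with $\Lambda_\Omega\subseteq\mathbb Z^n$ and $\rho(k_i)v_\lambda=q^{\lambda_i/2}v_\lambda$ for $i=1,\dots,n$, and set $c_\lambda=\|v_\lambda\|^2$. Let $\{(N^{(\lambda)}_t)_{t\in\mathbb R_+};\lambda\in\Lambda_\Omega\}$ be a family of independent (rate one) Poisson processes and define a jump process $(N_t)_{t\in\mathbb R_+}=((N_1(t),\dots,N_n(t)))_{t\in\mathbb R_+}$ with values in the lattice generated by $\Lambda_\Omega$ by $$N_t=\sum_{\lambda\in\Lambda_\Omega}\lambda\,N^{(\lambda)}_{c_\lambda t},\qquad t\in\mathbb R_+.$$ Then $$\big(\hat k_1(s,t),\dots,\hat k_n(s,t)\big)=\big(q^{(N_1(t)-N_1(s))/2},\dots,q^{(N_n(t)-N_n(s))/2}\big)$$ is a classical version of $(j_{st}(k_1),\dots,j_{st}(k_n))$, i.e. $$\Phi\big(j_{s_1t_1}(k^{\mu_1})\cdots j_{s_mt_m}(k^{\mu_m})\big)=\mathbb E\big(\hat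 k^{\mu_1}(s_1,t_1)\cdots\hat k^{\mu_m}(s_m,t_m)\big)$$ for all $m\in\mathbb N$, $\mu_1,\dots,\mu_m\in\mathbb Z^n$ and all $s_l,t_l\in\mathbb R_+$ with $s_l\le t_l$, $l=1,\dots,m$.
   Context: Let $\mathfrak g$ be a complex simple Lie algebra with Cartan matrix $(a_{ij})_{1\le i,j\le n}$, let $(d_i)_{1\le i\le n}$ be non-zero integers with $d_ia_{ij}=d_ja_{ji}$ and greatest common divisor $1$, let $q>0$ with $q^{2d_i}\neq 1$ for all $i$, and put $q_i=q^{d_i}$. $\mathcal U$ is the unital associative complex algebra $U_q(\mathfrak g)$ generated by $e_i,f_i,k_i,k_i^{-1}$ ($1\le i\le n$) with relations $k_ik_i^{-1}=k_i^{-1}k_i=1$, $k_ik_j=k_jk_i$, $k_ie_j=q_i^{a_{ij}/2}e_jk_i$, $k_if_j=q_i^{-a_{ij}/2}f_jk_i$, $e_if_j-f_je_i=\delta_{ij}\frac{k_i^2-k_i^{-2}}{q_i-q_i^{-1}}$, and for $i\ne j$ the relations $\sum_{\nu=0}^{1-a_{ij}}\binom{1-a_{ij}}{\nu}_{q_i}(-1)^\nu e_i^{1-a_{ij}-\nu}e_je_i^\nu=0$ and the same with $f$ in place of $e$, where $\binom{m}{\nu}_q=\frac{[m]_q!}{[\nu]_q![m-\nu]_q!}$, $[m]_q!=[1]_q\cdots[m]_q$, $[m]_q=\frac{q^m-q^{-m}}{q-q^{-1}}$. It is a bialgebra via $\Delta(e_i)=e_i\otimes k_i^{-1}+k_i\otimes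 e_i$, $\Delta(f_i)=f_i\otimes k_i^{-1}+k_i\otimes f_i$, $\Delta(k_i^{\pm1})=k_i^{\pm1}\otimes k_i^{\pm1}$, $\varepsilon(e_i)=\varepsilon(f_i)=0$, $\varepsilon(k_i^{\pm1})=1$, and a $*$-bialgebra via the antilinear anti-involution $e_i^*=f_i$, $f_i^*=e_i$, $k_i^*=k_i$. For $\mu\in\mathbb Z^n$, $k^\mu=k_1^{\mu_1}\cdots k_n^{\mu_n}$ and $\hat k^\mu=\hat k_1^{\mu_1}\cdots\hat k_n^{\mu_n}$. A unitary representation of $\mathcal U$ on a pre-Hilbert space $D$ is a unital homomorphism $\rho$ to the linear operators on $D$ with $\langle \rho(u)v,w\rangle=\langle v,\rho(u^* )w\rangle$. As in the paper, $D$ is taken to be an orthogonal direct sum of unitary irreducible representations and decomposes into joint eigenspaces of $k_1,\dots,k_n$, with joint eigenvalues of the form $(q^{\lambda_1/2},\dots,q^{\lambda_n/2})$, $\lambda\in\mathbb Z^n$; hence every $\Omega\in D$ has a decomposition as in the claim. Lévy process: a family of $*$-homomorphisms $(j_{st})_{0\le s\le t}$ from a $*$-bialgebra $\mathcal B$ to a $*$-algebra $\mathcal A$ with a fixed state $\Phi$ such that (i) $[j_{st}(\mathcal B),j_{s't'}(\mathcal B)]=\{0\}$ for $0\le s\le t\le s'\le t'$, and $\Phi(j_{s_1t_1}(b_1)\cdots j_{s_mt_m}(b_m))=\prod_l\Phi(j_{s_lt_l}(b_l))$ for $0\le s_1\le t_1\le s_2\le\cdots\le t_m$ and $b_l\in\mathcal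 B$; (ii) $m_{\mathcal A}\circ(j_{st}\otimes j_{tu})\circ\Delta=j_{su}$ for $0\le s\le t\le u$; (iii) $\varphi_{st}=\Phi\circ j_{st}$ depends only on $t-s$; (iv) $j_{ss}(b)=\varepsilon(b)1$ and $j_{st}(b)\to\varepsilon(b)1$ as $t\searrow s$ (in the sense $\Phi(j_{st}(b))\to\varepsilon(b)$). Its generator is the functional $\psi$ with $\Phi\circ j_{st}=\exp_\star((t-s)\psi)=\varepsilon+(t-s)\psi+\frac{(t-s)^2}{2}\psi\star\psi+\cdots$, where $\psi\star\psi=(\psi\otimes\psi)\circ\Delta$ etc. *)

(* Defs.v *)
From HB Require Import structures.
From mathcomp Require Import all_boot all_order all_algebra.
From mathcomp Require Import finmap complex.
From mathcomp Require Import all_classical all_reals all_analysis.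

Set Implicit Arguments.
Unset Strict Implicit.
Unset Printing Implicit Defensive.

Import Order.TTheory GRing.Theory Num.Theory.
Import numFieldNormedType.Exports.

#[global] Open Scope classical_set_scope.
#[global] Open Scope complex_scope.
#[global] Open Scope ring_scope.

Section LieAlgebra.
Context {F : fieldType} {L : vectType F}.
Variable br : L -> L -> L.

Definition lie_bracket : Prop :=
  [/\ forall x, linear (br x),
      forall y, linear (br^~ y),
      forall x, br x x = 0
    & forall x y z, br x (br y z) + br y (br z x) + br z (br x y) = 0].

Definition lie_ideal (I : {vspace L}) : Prop :=
  forall x y, y \in I -> br x y \in I.

Definition simple_lie_algebra : Prop :=
  [/\ lie_bracket,
      exists x y, br x y != 0
    & forall I : {vspace L}, lie_ideal I -> I = 0%VS \/ I = fullv].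

Definition ad_diagonalizable (x : L) : Prop :=
  exists2 X : seq L, basis_of fullv X
    & forall y, y \in X -> exists c : F, br x y = c *: y.

Definition toral (H : {vspace L}) : Prop :=
  (forall x y, x \in H -> y \in H -> br x y \in H) /\
  (forall x, x \in H -> ad_diagonalizable x).

(* For a semisimple Lie algebra over an algebraically closed field of
   characteristic 0 these are the Cartan subalgebras. *)
Definition maximal_toral (H : {vspace L}) : Prop :=
  toral H /\ forall H', toral H' -> (H <= H')%VS -> H' = H.

Section Roots.
Variable H : {vspace L}.
Local Notation dual := 'Hom(subvs_of H, F^o).

Definition root_space (alpha : dual) : set L :=
  [set x | forall h : subvs_of H, br (vsval h) x = (alpha h : F) *: x].

Definition is_root (alpha : dual) : Prop :=
  alpha != 0 /\ exists2 x, x != 0 & root_space alpha x.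

Definition root_base n (alpha : n.-tuple dual) : Prop :=
  [/\ basis_of fullv alpha,
      forall i, is_root (tnth alpha i)
    & forall beta, is_root beta -> exists m : 'I_n -> nat,
        beta = \sum_i tnth alpha i *+ m i \/
        beta = - \sum_i tnth alpha i *+ m i].

Definition is_coroot (alpha : dual) (h : subvs_of H) : Prop :=
  (alpha h = 2%:R :> F) /\
  exists x y, [/\ root_space alpha x, root_space (- alpha) y
                & vsval h = br x y].

End Roots.

(* a_ij = alpha_j(h_i) with h_i the coroot of the simple root alpha_i *)
Definition is_cartan_matrix n (a : 'M[int]_n) : Prop :=
  exists (H : {vspace L}) (alpha : n.-tuple 'Hom(subvs_of H, F^o))
         (h : 'I_n -> subvs_of H),
    [/\ maximal_toral H,
        root_base alpha,
        forall i, is_coroot (tnth alpha i) (h i)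
      & forall i j, tnth alpha j (h i) = (a i j)%:~R :> F].

End LieAlgebra.

Section Tensor.
Context {K : comNzRingType} {A B : lmodType K}.
Local Open Scope quotient_scope.

Definition bilin {W : lmodType K} (f : A -> B -> W) : Prop :=
  (forall x, linear (f x)) /\ (forall y, linear (f^~ y)).

Definition tens_sum {W : zmodType} (f : A -> B -> W) (s : seq (A * B)) : W :=
  \sum_(p <- s) f p.1 p.2.

(* A list of pairs stands for the formal sum of the elementary tensors a (x) b;
   two formal sums agree in the tensor product iff no bilinear map separates
   them. *)
Definition tens_rel (s t : seq (A * B)) : Prop :=
  forall (W : lmodType K) (f : A -> B -> W), bilin f ->
    tens_sum f s = tens_sum f t.

Definition tens_relb : rel (seq (A * B)) := fun s t => `[< tens_rel s t >].

Lemma tens_relb_refl : reflexive tens_relb.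
Proof. by move=> s; apply/asboolP. Qed.

Lemma tens_relb_sym : symmetric tens_relb.
Proof.
by move=> s t; apply/asboolP/asboolP => h W f bf; rewrite (h W f bf).
Qed.

Lemma tens_relb_trans : transitive tens_relb.
Proof.
move=> t s u /asboolP h1 /asboolP h2; apply/asboolP => W f bf.
by rewrite (h1 W f bf) (h2 W f bf).
Qed.

Canonical tens_equiv :=
  EquivRel tens_relb tens_relb_refl tens_relb_sym tens_relb_trans.

Definition tensor := {eq_quot tens_relb}.
HB.instance Definition _ := Choice.on tensor.
HB.instance Definition _ := EqQuotient.on tensor.

(* The linear map on the tensor product induced by a bilinear map f; see
   tens_liftE below. *)
Definition tens_lift {W : zmodType} (f : A -> B -> W) (x : tensor) : W :=
  tens_sum f (repr x).

Lemma tens_lift_pi (W : lmodType K) (f : A -> B -> W) s :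
  bilin f -> tens_lift f (\pi_tensor s) = tens_sum f s.
Proof.
move=> bf; rewrite /tens_lift.
have : tens_relb (repr (\pi_tensor s)) s by apply/eqmodP; rewrite reprK.
by move/asboolP/(_ W f bf).
Qed.

Lemma tensorP (x y : tensor) :
  (forall (W : lmodType K) (f : A -> B -> W), bilin f ->
     tens_lift f x = tens_lift f y) -> x = y.
Proof.
move=> h; rewrite -[x]reprK -[y]reprK; apply/eqmodP/asboolP => W f bf.
exact: h.
Qed.

Definition tens_zero : tensor := \pi_tensor [::].
Definition tens_add (x y : tensor) : tensor := \pi_tensor (repr x ++ repr y).
Definition tens_scale (c : K) (x : tensor) : tensor :=
  \pi_tensor [seq (c *: p.1, p.2) | p <- repr x].
Definition tens_opp : tensor -> tensor := tens_scale (-1).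

Lemma tens_lift0 (W : lmodType K) (f : A -> B -> W) :
  bilin f -> tens_lift f tens_zero = 0.
Proof. by move=> bf; rewrite tens_lift_pi// /tens_sum big_nil. Qed.

Lemma tens_liftD (W : lmodType K) (f : A -> B -> W) x y :
  bilin f -> tens_lift f (tens_add x y) = tens_lift f x + tens_lift f y.
Proof. by move=> bf; rewrite tens_lift_pi// /tens_sum big_cat. Qed.

Lemma tens_liftZ (W : lmodType K) (f : A -> B -> W) c x :
  bilin f -> tens_lift f (tens_scale c x) = c *: tens_lift f x.
Proof.
move=> bf; rewrite tens_lift_pi// /tens_sum big_map scaler_sumr.
apply: eq_bigr => -[a b] _ /=; have l := bf.2 b.
have h0 : f 0 b = 0.
  have := l 1 0 0; rewrite !scale1r addr0 => /eqP.
  by rewrite -subr_eq0 opprD addrA subrr add0r oppr_eq0 => /eqP.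
by have := l c a 0; rewrite h0 !addr0.
Qed.

Lemma tens_addA : associative tens_add.
Proof. by move=> x y z; apply: tensorP => W f bf; rewrite !tens_liftD// addrA. Qed.

Lemma tens_addC : commutative tens_add.
Proof. by move=> x y; apply: tensorP => W f bf; rewrite !tens_liftD// addrC. Qed.

Lemma tens_add0 : left_id tens_zero tens_add.
Proof.
by move=> x; apply: tensorP => W f bf; rewrite tens_liftD// tens_lift0// add0r.
Qed.

Lemma tens_addN : left_inverse tens_zero tens_opp tens_add.
Proof.
move=> x; apply: tensorP => W f bf.
by rewrite tens_liftD// tens_lift0// tens_liftZ// scaleN1r addNr.
Qed.

HB.instance Definition _ :=
  GRing.isZmodule.Build tensor tens_addA tens_addC tens_add0 tens_addN.

Lemma tens_scaleA a b x :
  tens_scale a (tens_scale b x) = tens_scale (a * b) x.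
Proof. by apply: tensorP => W f bf; rewrite !tens_liftZ// scalerA. Qed.

Lemma tens_scale1 : left_id 1 tens_scale.
Proof. by move=> x; apply: tensorP => W f bf; rewrite tens_liftZ// scale1r. Qed.

Lemma tens_scaleDr : right_distributive tens_scale +%R.
Proof.
move=> c x y; apply: tensorP => W f bf.
by rewrite tens_liftZ// !tens_liftD// !tens_liftZ// scalerDr.
Qed.

Lemma tens_scaleDl x : {morph tens_scale^~ x : a b / a + b}.
Proof.
move=> a b; apply: tensorP => W f bf.
by rewrite tens_liftD// !tens_liftZ// scalerDl.
Qed.

HB.instance Definition _ := GRing.Zmodule_isLmodule.Build K tensor
  tens_scaleA tens_scale1 tens_scaleDr tens_scaleDl.

Definition tens (a : A) (b : B) : tensor := \pi_tensor [:: (a, b)].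

Lemma tens_liftE (W : lmodType K) (f : A -> B -> W) a b :
  bilin f -> tens_lift f (tens a b) = f a b.
Proof. by move=> bf; rewrite tens_lift_pi// /tens_sum big_seq1. Qed.

Lemma tens_lift_linear (W : lmodType K) (f : A -> B -> W) :
  bilin f -> linear (tens_lift f).
Proof.
move=> bf c x y; rewrite -(tens_liftZ _ _ bf) -(tens_liftD _ _ bf).
by [].
Qed.

Lemma tens_bilin : bilin tens.
Proof.
split=> [a c b b'|b c a a']; apply: tensorP => W f bf;
  by rewrite tens_lift_linear// !tens_liftE// (bf.1, bf.2).
Qed.

Lemma tens_generate (x : tensor) :
  x = \sum_(p <- repr x) tens p.1 p.2.
Proof.
apply: tensorP => W f bf.
pose g : {linear tensor -> W} := HB.pack (tens_lift f)
  (GRing.isLinear.Build _ _ _ _ _ (tens_lift_linear bf)).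
rewrite -[RHS]/(g _) linear_sum /=; apply: eq_bigr => p _.
by rewrite tens_liftE.
Qed.

End Tensor.

Arguments tensor {K} A B.
Notation "a ⊗ b" := (tens a b) (at level 35, right associativity) : ring_scope.

Section StarBialgebra.
Context {R : realType}.
Local Notation C := R[i].

Definition is_involution (A : algType C) (star : A -> A) : Prop :=
  [/\ forall (c : C) x y, star (c *: x + y) = conjc c *: star x + star y,
      forall x y, star (x * y) = star y * star x
    & involutive star].

Definition tens_mul {A B : algType C} (x y : tensor A B) : tensor A B :=
  tens_lift (fun a b => tens_lift (fun a' b' => (a * a') ⊗ (b * b')) y) x.

Lemma tens_mul_bilin {A B : algType C} (a : A) (b : B) :
  bilin (fun a' b' => (a * a') ⊗ (b * b')).
Proof.
split=> [a' c x y|b' c x y] /=.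
  by rewrite mulrDr -scalerAr (tens_bilin.1 _).
by rewrite mulrDr -scalerAr (tens_bilin.2 _).
Qed.

Lemma tens_mulE {A B : algType C} (a a' : A) (b b' : B) :
  tens_mul (a ⊗ b) (a' ⊗ b') = (a * a') ⊗ (b * b').
Proof.
rewrite /tens_mul tens_liftE ?tens_liftE//; first exact: tens_mul_bilin.
split=> [x c y z|x c y z] /=; rewrite !tens_liftE; do ?exact: tens_mul_bilin.
  by rewrite mulrDl -scalerAl (tens_bilin.1 _).
by rewrite mulrDl -scalerAl (tens_bilin.2 _).
Qed.

Record is_star_bialgebra (B : algType C) (star : B -> B)
    (Delta : B -> tensor B B) (eps : B -> C) : Prop := IsStarBialgebra {
  bialg_star : is_involution star;
  bialg_Delta_linear : linear Delta;
  bialg_Delta1 : Delta 1 = 1 ⊗ 1;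
  bialg_DeltaM : forall x y, Delta (x * y) = tens_mul (Delta x) (Delta y);
  bialg_eps_linear : scalar eps;
  bialg_epsM : monoid_morphism eps;
  (* (Delta (x) id) o Delta = (id (x) Delta) o Delta *)
  bialg_coassoc : forall x,
    tens_lift (fun a b => tens_lift (fun a1 a2 => a1 ⊗ (a2 ⊗ b)) (Delta a))
      (Delta x)
    = tens_lift (fun a b => a ⊗ Delta b) (Delta x) :> tensor B (tensor B B);
  bialg_counitl : forall x, tens_lift (fun a b => eps a *: b) (Delta x) = x;
  bialg_counitr : forall x, tens_lift (fun a b => eps b *: a) (Delta x) = x;
  (* the involution of the tensor square is (a (x) b)^* = a^* (x) b^* *)
  bialg_Delta_star : forall x (s : seq (B * B)),
    Delta x = \sum_(p <- s) p.1 ⊗ p.2 ->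
    Delta (star x) = \sum_(p <- s) star p.1 ⊗ star p.2;
  bialg_eps_star : forall x, eps (star x) = conjc (eps x) }.

Section Convolution.
Context {B : algType C}.
Variables (Delta : B -> tensor B B) (eps : B -> C).

Definition convolution (phi psi : B -> C) (b : B) : C :=
  tens_lift (fun x y => phi x * psi y) (Delta b).

Fixpoint convolution_pow (psi : B -> C) (m : nat) : B -> C :=
  if m is m'.+1 then convolution (convolution_pow psi m') psi else eps.

(* l = exp_*(tau psi)(b), the series being required to converge *)
Definition is_convolution_exp (psi : B -> C) (tau : R) (b : B) (l : C) : Prop :=
  series (fun m => (tau ^+ m / m`!%:R)%:C * convolution_pow psi m b : C^o)
    @ \oo --> (l : C^o).

End Convolution.

Definition is_state (A : algType C) (star : A -> A) (Phi : A -> C) : Prop :=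
  [/\ scalar Phi, Phi 1 = 1 & forall x, 0 <= Phi (star x * x)].

Record is_star_hom (A B : algType C) (starA : A -> A) (starB : B -> B)
    (h : A -> B) : Prop := IsStarHom {
  star_hom_linear : linear h;
  star_homM : monoid_morphism h;
  star_homS : forall x, h (starA x) = starB (h x) }.

Record is_levy_process (B : algType C) (starB : B -> B)
    (Delta : B -> tensor B B) (eps : B -> C)
    (A : algType C) (starA : A -> A) (Phi : A -> C)
    (j : R -> R -> B -> A) : Prop := IsLevyProcess {
  levy_star_hom : forall s t, 0 <= s <= t -> is_star_hom starB starA (j s t);
  levy_commute : forall s t s' t' b b',
    0 <= s <= t -> t <= s' <= t' ->
    j s t b * j s' t' b' = j s' t' b' * j s t b;
  levy_independent : forall m (s t : 'I_m -> R) (b : 'I_m -> B),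
    (forall l, 0 <= s l <= t l) ->
    (forall l l' : 'I_m, (l < l')%N -> t l <= s l') ->
    Phi (\prod_(l < m) j (s l) (t l) (b l))
      = \prod_(l < m) Phi (j (s l) (t l) (b l));
  levy_increment : forall s t u b, 0 <= s <= t -> t <= u ->
    tens_lift (fun x y => j s t x * j t u y) (Delta b) = j s u b;
  levy_stationary : forall s t s' t' b,
    0 <= s <= t -> 0 <= s' <= t' -> t - s = t' - s' ->
    Phi (j s t b) = Phi (j s' t' b);
  levy_start : forall s b, 0 <= s -> j s s b = (eps b)%:A;
  levy_continuous : forall s b, 0 <= s ->
    (Phi (j s t b) : C^o) @[t --> s^'+] --> (eps b : C^o) }.

Definition is_generator (B : algType C) (Delta : B -> tensor B B)
    (eps : B -> C) (A : algType C) (Phi : A -> C) (j : R -> R -> B -> A)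
    (psi : B -> C) : Prop :=
  forall s t b, 0 <= s <= t ->
    is_convolution_exp Delta eps psi (t - s) b (Phi (j s t b)).

End StarBialgebra.

Section QuantumNumbers.
Context {F : fieldType}.
Implicit Types (q : F) (m nu : nat).

Definition qnum q m : F := (q ^+ m - q ^- m) / (q - q^-1).
Definition qfact q m : F := \prod_(1 <= l < m.+1) qnum q l.
Definition qbinom q m nu : F := qfact q m / (qfact q nu * qfact q (m - nu)).

End QuantumNumbers.

Section Uq.
Context {R : realType} {n : nat}.
Local Notation C := R[i].
Variables (a : 'M[int]_n) (d : 'I_n -> int) (q : R).

Definition symmetrizes : Prop :=
  [/\ forall i, d i != 0,
      forall i j, d i * a i j = d j * a j i
    & \big[gcdn/0%N]_(i < n) `|d i|%N = 1%N].

Definition q_ (i : 'I_n) : R := q ^ d i.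

Definition q_half (i j : 'I_n) : R := q_ i `^ ((a i j)%:~R / 2).

Definition serre (U : algType C) (x : 'I_n -> U) (i j : 'I_n) : Prop :=
  let m := `|1 - a i j|%N in (* = 1 - a_ij, since a_ij <= 0 for i <> j *)
  \sum_(nu < m.+1) (qbinom (q_ i) m nu * (-1) ^+ nu)%:C *:
     (x i ^+ (m - nu) * x j * x i ^+ nu) = 0.

(* k' i stands for k_i^(-1) *)
Record Uq_relations (U : algType C) (e f k k' : 'I_n -> U) : Prop :=
    UqRelations {
  Uq_kk' : forall i, k i * k' i = 1;
  Uq_k'k : forall i, k' i * k i = 1;
  Uq_kC : forall i j, k i * k j = k j * k i;
  Uq_ke : forall i j, k i * e j = (q_half i j)%:C *: (e j * k i);
  Uq_kf : forall i j, k i * f j = ((q_half i j)^-1)%:C *: (f j * k i);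
  Uq_ef : forall i j, e i * f j - f j * e i =
    (if i == j then ((q_ i - (q_ i)^-1)^-1)%:C *: (k i ^+ 2 - k' i ^+ 2)
     else 0);
  Uq_serre_e : forall i j : 'I_n, i != j -> serre e i j;
  Uq_serre_f : forall i j : 'I_n, i != j -> serre f i j }.

(* U is the algebra presented by the generators e, f, k, k' and the relations
   above: it is universal among algebras with such elements. *)
Record is_Uq (U : algType C) (e f k k' : 'I_n -> U) : Prop := IsUq {
  Uq_rel : Uq_relations e f k k';
  Uq_lift : forall (V : algType C) (e1 f1 k1 k1' : 'I_n -> V),
    Uq_relations e1 f1 k1 k1' -> exists h : {lrmorphism U -> V}, forall i,
      [/\ h (e i) = e1 i, h (f i) = f1 i, h (k i) = k1 i & h (k' i) = k1' i];
  Uq_lift_uniq : forall (V : algType C) (h1 h2 : {lrmorphism U -> V}),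
    (forall i, [/\ h1 (e i) = h2 (e i), h1 (f i) = h2 (f i),
                   h1 (k i) = h2 (k i) & h1 (k' i) = h2 (k' i)]) ->
    h1 =1 h2 }.

(* the *-bialgebra structure, determined by its values on the generators *)
Record is_Uq_star_bialgebra (U : algType C) (e f k k' : 'I_n -> U)
    (star : U -> U) (Delta : U -> tensor U U) (eps : U -> C) : Prop :=
    IsUqStarBialgebra {
  Uq_star_bialgebra : is_star_bialgebra star Delta eps;
  Uq_Delta_e : forall i, Delta (e i) = e i ⊗ k' i + k i ⊗ e i;
  Uq_Delta_f : forall i, Delta (f i) = f i ⊗ k' i + k i ⊗ f i;
  Uq_Delta_k : forall i, Delta (k i) = k i ⊗ k i;
  Uq_Delta_k' : forall i, Delta (k' i) = k' i ⊗ k' i;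
  Uq_eps_e : forall i, eps (e i) = 0;
  Uq_eps_f : forall i, eps (f i) = 0;
  Uq_eps_k : forall i, eps (k i) = 1;
  Uq_eps_k' : forall i, eps (k' i) = 1;
  Uq_star_e : forall i, star (e i) = f i;
  Uq_star_f : forall i, star (f i) = e i;
  Uq_star_k : forall i, star (k i) = k i }.

Definition zpow (U : algType C) (x x' : U) (m : int) : U :=
  match m with Posz p => x ^+ p | Negz p => x' ^+ p.+1 end.

Definition kmon (U : algType C) (k k' : 'I_n -> U) (mu : 'rV[int]_n) : U :=
  \prod_(i < n) zpow (k i) (k' i) (mu 0 i).

End Uq.

Section UnitaryRep.
Context {R : realType}.
Local Notation C := R[i].
Context {U : algType C} {D : lmodType C}.
Variables (star : U -> U) (ip : {dot D for @conjc R}).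

(* The forms {dot D for conjc} are linear in the first argument; the scalar
   product <v, w> here is linear in the second one. *)
Definition braket (v w : D) : C := ip w v.

Definition sqnorm (v : D) : R := complex.Re (braket v v).

Record is_unitary_rep (rho : U -> D -> D) : Prop := IsUnitaryRep {
  rep_linear_op : forall u, linear (rho u);
  rep_linear : forall (c : C) u u' v,
    rho (c *: u + u') v = c *: rho u v + rho u' v;
  rep1 : forall v, rho 1 v = v;
  repM : forall u u' v, rho (u * u') v = rho u (rho u' v);
  rep_unitary : forall u v w, braket (rho u v) w = braket v (rho (star u) w) }.

Variable rho : U -> D -> D.

Definition invariant_subspace (E : set D) : Prop :=
  [/\ E 0, forall (c : C) x y, E x -> E y -> E (c *: x + y)
    & forall u x, E x -> E (rho u x)].

Definition irreducible_subspace (E : set D) : Prop :=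
  [/\ invariant_subspace E, E != [set 0]
    & forall E' : set D, invariant_subspace E' -> E' `<=` E ->
        E' = [set 0] \/ E' = E].

Definition orthogonal_sum_of_irreducibles : Prop :=
  exists (I : Type) (E : I -> set D),
    [/\ forall i, irreducible_subspace (E i),
        forall i i', i <> i' -> forall x y, E i x -> E i' y -> braket x y = 0
      & forall x : D, exists (r : seq I) (y : I -> D),
          (forall i, E i (y i)) /\ x = \sum_(i <- r) y i].

Context {n : nat}.
Variables (q : R) (k : 'I_n -> U).

Definition weight_vector (lam : 'rV[int]_n) (v : D) : Prop :=
  forall i, rho (k i) v = (q `^ ((lam 0 i)%:~R / 2))%:C *: v.

Definition sum_of_weight_spaces : Prop :=
  forall x : D, exists (Lam : {fset 'rV[int]_n}) (v : 'rV[int]_n -> D),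
    (forall lam, lam \in Lam -> weight_vector lam (v lam)) /\
    x = \sum_(lam <- Lam) v lam.

End UnitaryRep.

Section Poisson.
Context {R : realType} {disp : measure_display} {T : measurableType disp}.
Variable P : probability T R.

Definition independent_classes (I : choiceType) (S : set I)
    (F : I -> set (set T)) : Prop :=
  forall (J : {fset I}) (A : I -> set T),
    [set` J] `<=` S -> (forall i, i \in J -> F i (A i)) ->
    P (\bigcap_(i in [set` J]) A i) = (\prod_(i <- J) P (A i))%E.

Definition sigma_rv (X : T -> nat) : set (set T) :=
  preimage_set_system [set: T] X measurable.

Definition sigma_process (N : R -> T -> nat) : set (set T) :=
  <<s \bigcup_(t in [set t : R | 0 <= t]) sigma_rv (N t) >>.

(* The second argument of poisson_prob is a dummy; poisson_prob 0 is the Dirac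
   mass at 0. The subtraction of naturals is harmless, paths being almost
   surely nondecreasing. *)
Record is_poisson_process (N : R -> T -> nat) : Prop := IsPoissonProcess {
  poisson_measurable : forall t, 0 <= t -> measurable_fun [set: T] (N t);
  poisson_paths : {ae P, forall w,
    [/\ N 0 w = 0%N,
        forall s t, 0 <= s <= t -> (N s w <= N t w)%N
      & forall t, 0 <= t -> \forall u \near t^'+, N u w = N t w]};
  poisson_indep_increments : forall t : nat -> R, 0 <= t 0%N ->
    (forall l, t l <= t l.+1) ->
    independent_classes [set: nat]
      (fun l => sigma_rv (fun w => (N (t l.+1) w - N (t l) w)%N));
  poisson_increments : forall s t, 0 <= s <= t -> forall A : set nat,
    P [set w | A (N t w - N s w)%N] = poisson_prob (t - s) 0%N A }.

Definition independent_processes (I : choiceType) (S : set I)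
    (N : I -> R -> T -> nat) : Prop :=
  independent_classes S (fun i => sigma_process (N i)).

Context {n : nat}.

Definition jump_process (Lam : {fset 'rV[int]_n}) (c : 'rV[int]_n -> R)
    (N : 'rV[int]_n -> R -> T -> nat) (t : R) (w : T) : 'rV[int]_n :=
  \sum_(lam <- Lam) lam *+ N lam (c lam * t) w.

Definition khat (q : R) (N : R -> T -> 'rV[int]_n) (i : 'I_n) (s t : R) (w : T)
    : R :=
  q `^ ((N t w 0 i - N s w 0 i)%:~R / 2).

Definition khat_mon (q : R) (N : R -> T -> 'rV[int]_n) (mu : 'rV[int]_n)
    (s t : R) (w : T) : R :=
  \prod_(i < n) khat q N i s t w ^ (mu 0 i).

End Poisson.

(* Main.v *)
Require Import Defs.
From HB Require Import structures.
From mathcomp Require Import all_boot all_order all_algebra.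
From mathcomp Require Import finmap complex.
From mathcomp Require Import all_classical all_reals all_analysis.
From mathcomp Require Import measurable_realfun.

(** The monomials [k^mu] are group-like, so on them convolution powers become
ordinary powers and [Phi (j s t (k^mu)) = exp ((t - s) * psi (k^mu))].  Weight
vectors of distinct weights are orthogonal, because [k_i] is self-adjoint and
[q <> 1], hence [psi (k^mu) = \sum_lam c_lam (q^(<lam,mu>/2) - 1)], which is the
exponent of the generating function of the increments of
[\sum_lam lam N^lam_(c_lam t)].  Overlapping time intervals are reduced to
disjoint ones: both [j s t (k^mu)] and [khat^mu (s, t)] are multiplicative in
[mu] and under concatenation of intervals, so a product over arbitrary intervals
can be rewritten as a product over the cells of a common refinement, where
independence of increments applies. *)

Set Implicit Arguments.
Unset Strict Implicit.
Unset Printing Implicit Defensive.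

Import Order.TTheory GRing.Theory Num.Theory.
Import numFieldNormedType.Exports.

(** * Reduction of overlapping intervals to the cells of a common grid *)

Lemma prodrM_commute (A : pzRingType) (I : Type) (r : seq I) (x y : I -> A) :
  (forall i j, GRing.comm (x i) (y j)) ->
  (\prod_(i <- r) x i) * (\prod_(i <- r) y i) = \prod_(i <- r) (x i * y i).
Proof.
move=> xyC; elim: r => [|i r IH]; first by rewrite !big_nil mulr1.
rewrite !big_cons -IH -!mulrA; congr (_ * _); rewrite !mulrA; congr (_ * _).
by apply/commr_sym/commr_prod => j _; exact/commr_sym.
Qed.

Section Refinement.
Variables (V : nmodType) (A : pzRingType) (h : nat -> nat -> V -> A).
Hypothesis h_refl : forall p mu, h p p mu = 1.
Hypothesis h_0 : forall p r, (p <= r)%N -> h p r 0 = 1.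
Hypothesis h_D : forall p r mu nu, (p <= r)%N ->
  h p r (mu + nu) = h p r mu * h p r nu.
Hypothesis h_trans : forall p r u mu, (p <= r <= u)%N ->
  h p u mu = h p r mu * h r u mu.
Hypothesis h_comm : forall p r u w mu nu, (p <= r)%N -> (r <= u <= w)%N ->
  GRing.comm (h u w nu) (h p r mu).

(** The cells between [a] and [b] telescope by [h_trans]; every other cell carries the label 0 and
    contributes the factor 1. In the application [p] and [r] index grid times, and [h] is either the
    noncommutative increment of [j] or the classical one. *)
Lemma refine_increment a b M mu : (a <= b <= M)%N ->
  h a b mu =
  \prod_(0 <= p < M) h p p.+1 (if (a <= p < b)%N then mu else 0).
Proof.
case/andP; rewrite leq_eqVlt => /predU1P[-> _|].
  rewrite h_refl big1// => p _; case: ifPn; last by rewrite h_0.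
  by case/andP => /leq_ltn_trans h1 /h1; rewrite ltnn.
elim: M b => [|M IH] b; first by case: b.
move=> ab; rewrite leq_eqVlt => /predU1P[bE|].
  rewrite bE in ab *; rewrite big_nat_recr //=.
  have aM : (a <= M)%N by rewrite -ltnS.
  rewrite aM leqnn /= (@h_trans a M M.+1) ?aM ?leqnSn//; congr (_ * _).
  move: aM; rewrite leq_eqVlt => /predU1P[->|{}ab].
    rewrite h_refl big_nat big1// => p /andP[_ pM].
    by rewrite leqNgt pM h_0.
  rewrite (IH M)// !big_nat; apply: eq_bigr => p /andP[_ pM].
  by rewrite pM (ltnW pM : p < M.+1)%N.
rewrite ltnS => bM; rewrite big_nat_recr //= -(IH b)// [(M < b)%N]ltnNge bM.
by rewrite andbF h_0 ?mulr1.
Qed.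

(** Each interval is spread over all cells and the products are merged cell by cell, so that a cell
    collects the labels of the intervals containing it. This is how overlaps disappear. *)
Lemma refine_increments (I : Type) (r : seq I) (a b : I -> nat) M
    (mu : I -> V) : (forall l, (a l <= b l <= M)%N) ->
  \prod_(l <- r) h (a l) (b l) (mu l) =
  \prod_(0 <= p < M)
     h p p.+1 (\sum_(l <- r) if (a l <= p < b l)%N then mu l else 0).
Proof.
move=> abM; elim: r => [|l r IH].
  by rewrite big_nil big1// => p _; rewrite big_nil h_0.
rewrite big_cons IH (@refine_increment _ _ M)// prodrM_commute.
  by apply: eq_bigr => p _; rewrite big_cons h_D.
move=> p p'; have [pp'|pp'|->] := ltngtP p p'.
- by apply/commr_sym/h_comm => //; rewrite pp' leqnSn.
- by apply: h_comm => //; rewrite pp' leqnSn.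
(* Within one cell, commutation comes from commutativity of addition in [V], through [h_D]. *)
- by rewrite /GRing.comm -!h_D// addrC.
Qed.

End Refinement.

(** The grid is the sorted list of all endpoints, and [a], [b] are positions in that list. *)
Lemma sorted_grid (R : realDomainType) (m : nat) (s t : 'I_m -> R) :
  (forall l, 0 <= s l <= t l) ->
  exists (tau : nat -> R) (M : nat) (a b : 'I_m -> nat),
    [/\ forall p, 0 <= tau p,
        forall p r, (p <= r)%N -> tau p <= tau r,
        forall l, tau (a l) = s l,
        forall l, tau (b l) = t l
      & forall l, (a l <= b l <= M)%N].
Proof.
move=> st.
pose r := sort <=%O ([seq s l | l <- enum 'I_m] ++ [seq t l | l <- enum 'I_m]).
have sr l : s l \in r by rewrite mem_sort mem_cat map_f ?mem_enum.
have tr l : t l \in r by rewrite mem_sort mem_cat map_f ?mem_enum ?orbT.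
have r0 x : x \in r -> 0 <= x.
  rewrite mem_sort mem_cat => /orP[] /mapP[l _ ->].
    by case/andP: (st l).
  by case/andP: (st l); exact: le_trans.
have sorted_r : sorted <=%O r by apply: sort_sorted; exact: le_total.
(* The index is clamped to the last entry: past the end of the list the default 0 of [nth] would
   break monotonicity. *)
pose tau p := nth 0 r (minn p (size r).-1).
have tau_index x : x \in r -> tau (index x r) = x.
  move=> xr; rewrite /tau (minn_idPl _) ?nth_index//.
  by move: (xr); rewrite -index_mem; case: (size r).
exists tau, (size r), (fun l => index (s l) r), (fun l => index (t l) r).
split=> [p|p p' pp'|l|l|l]; rewrite ?tau_index//.
- rewrite /tau; have [/size0nil->|nr] := eqVneq (size r) 0%N.
    by rewrite nth_nil.
  apply/r0/mem_nth; rewrite (leq_ltn_trans (geq_minr _ _))//.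
  by case: (size r) nr.
- rewrite /tau; have [/size0nil->|nr] := eqVneq (size r) 0%N.
    by rewrite !nth_nil.
  have lt x : (minn x (size r).-1 < size r)%N.
    by rewrite (leq_ltn_trans (geq_minr _ _))//; case: (size r) nr.
  apply: (sorted_leq_nth le_trans) => //=; rewrite ?inE ?lt//.
  by rewrite leq_min geq_minr (leq_trans (geq_minl _ _)).
(* [index] gives first occurrences. An inversion would force [t l <= s l], hence [s l = t l], and
   equal endpoints have equal indices. *)
- rewrite index_size andbT leqNgt; apply/negP => ts.
  have := sorted_leq_nth le_trans lexx 0 sorted_r
    (index (t l) r) (index (s l) r).
  rewrite !inE !index_mem => /(_ (tr l) (sr l) (ltnW ts)).
  rewrite !nth_index// => tles; have /andP[_ slet] := st l.
  have /eqP e : s l == t l by rewrite eq_le slet tles.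
  by rewrite e ltnn in ts.
Qed.

(** * Real limits inside the complex numbers *)

Section RealComplex.
Variable R : realType.
Local Notation C := R[i].

Lemma normc_real (x : R) : `|x%:C| = `|x|%:C.
Proof. by rewrite normc_def /= expr0n addr0 sqrtr_sqr. Qed.

Lemma cvg_real_complex (u : nat -> R) (l : R) :
  u @ \oo --> l -> ((u p)%:C : C^o) @[p --> \oo] --> (l%:C : C^o).
Proof.
move=> /cvgrPdist_lt ul; apply/cvgrPdist_lt => -[x y].
(* A positive element of [R[i]] has zero imaginary part, so the radius is real. *)
rewrite ltcE /= => /andP[/eqP-> x0]; near=> p.
have -> : l%:C - (u p)%:C = (l - u p)%:C by rewrite rmorphB.
rewrite [X in X < _]normc_real ltcR; near: p; exact: ul.
Unshelve. all: by end_near. Qed.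

End RealComplex.

(** * Convolution at group-like elements *)

Section Grouplike.
Context {R : realType} {B : algType R[i]}.
Local Notation C := R[i].
Variables (star : B -> B) (Delta : B -> tensor B B) (eps : B -> C).
Hypothesis hB : is_star_bialgebra star Delta eps.

(** Bilinearity is the condition under which [tens_lift] can be evaluated on elementary tensors;
    hence convolution powers are shown to be linear below. *)
Lemma scalar_mul_bilin (phi psi : B -> C) : scalar phi -> scalar psi ->
  bilin (fun x y => phi x * psi y : C^o).
Proof.
move=> hphi hpsi; split=> [x c y y'|y c x x'].
  by rewrite hpsi mulrDr mulrCA.
by rewrite hphi mulrDl -mulrA.
Qed.

Lemma convolution_scalar (phi psi : B -> C) : scalar phi -> scalar psi ->
  scalar (convolution Delta phi psi).
Proof.
move=> hphi hpsi c x y; rewrite /convolution (bialg_Delta_linear hB).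
exact: (tens_lift_linear (scalar_mul_bilin hphi hpsi)).
Qed.

Lemma convolution_grouplike (phi psi : B -> C) b :
  scalar phi -> scalar psi -> Delta b = b ⊗ b ->
  convolution Delta phi psi b = phi b * psi b.
Proof.
move=> hphi hpsi hb; rewrite /convolution hb.
exact: (tens_liftE _ _ (scalar_mul_bilin hphi hpsi)).
Qed.

Lemma convolution_pow_scalar (psi : B -> C) m : scalar psi ->
  scalar (convolution_pow Delta eps psi m).
Proof.
move=> hpsi; elim: m => [|m IH] /=; first exact: (bialg_eps_linear hB).
exact: convolution_scalar.
Qed.

Lemma convolution_pow_grouplike (psi : B -> C) m b :
  scalar psi -> Delta b = b ⊗ b -> eps b = 1 ->
  convolution_pow Delta eps psi m b = psi b ^+ m.
Proof.
move=> hpsi hb eb; elim: m => [|m IH] /=; first by rewrite eb.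
rewrite convolution_grouplike ?IH ?exprSr//.
exact: convolution_pow_scalar.
Qed.

(** Term by term the series is the image of the real exponential series at [tau * x], and limits in
    [R[i]] are unique. *)
Lemma convolution_exp_grouplike (psi : B -> C) (tau x : R) b l :
  scalar psi -> Delta b = b ⊗ b -> eps b = 1 -> psi b = x%:C ->
  is_convolution_exp Delta eps psi tau b l -> l = (expR (tau * x))%:C.
Proof.
move=> hpsi hb eb psib; rewrite /is_convolution_exp => hl.
have hx : series (exp_coeff (tau * x)) @ \oo --> expR (tau * x).
  exact: is_cvg_series_exp_coeff.
have {hx}hx := cvg_real_complex hx.
apply: (cvg_unique (@norm_hausdorff _ C^o) hl).
apply: cvg_trans hx; apply: near_eq_cvg; near=> m.
rewrite /series /= rmorph_sum; apply: eq_bigr => p _.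
rewrite convolution_pow_grouplike// psib -rmorphXn -rmorphM.
by congr (_%:C); rewrite /exp_coeff /= exprMn mulrAC.
Unshelve. all: by end_near. Qed.

Lemma grouplikeM x y : Delta x = x ⊗ x -> Delta y = y ⊗ y ->
  Delta (x * y) = (x * y) ⊗ (x * y).
Proof. by move=> hx hy; rewrite (bialg_DeltaM hB) hx hy tens_mulE. Qed.

Lemma grouplikeX x m : Delta x = x ⊗ x -> Delta (x ^+ m) = x ^+ m ⊗ x ^+ m.
Proof.
move=> hx; elim: m => [|m IH]; first by rewrite expr0 (bialg_Delta1 hB).
by rewrite exprS grouplikeM.
Qed.

End Grouplike.

(** * Integer powers of an invertible element *)

Section Zpow.
Context {R : realType} {U : algType R[i]}.
Implicit Types (x y : U) (m p : int).

Lemma comm_inverse (x y y' : U) :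
  y * y' = 1 -> y' * y = 1 -> GRing.comm x y -> GRing.comm x y'.
Proof.
move=> yy' y'y xy; rewrite /GRing.comm.
by rewrite -[LHS]mul1r -y'y -mulrA [y * _]mulrA -xy -!mulrA yy' mulr1.
Qed.

Lemma comm_zpow x y y' m : y * y' = 1 -> y' * y = 1 ->
  GRing.comm x y -> GRing.comm x (zpow y y' m).
Proof.
move=> yy' y'y xy; case: m => m /=; apply: commrX => //.
exact: comm_inverse yy' y'y xy.
Qed.

Variables (x x' : U).
Hypotheses (xx' : x * x' = 1) (x'x : x' * x = 1).

Lemma zpowS m : zpow x x' (m + 1) = zpow x x' m * x.
Proof.
case: m => [m|[|m]].
- by rewrite -PoszD addn1 /= exprSr.
- by rewrite /= x'x.
- by rewrite NegzE addrC subzSS sub0r -NegzE /= [in RHS]exprSr -mulrA x'x mulr1.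
Qed.

Lemma zpowP m : zpow x x' (m - 1) = zpow x x' m * x'.
Proof. by rewrite -[in RHS](subrK 1 m) zpowS -mulrA xx' mulr1. Qed.

Lemma zpowD m p : zpow x x' (m + p) = zpow x x' m * zpow x x' p.
Proof.
elim: p => [|p IH|p IH]; first by rewrite addr0 mulr1.
  by rewrite -addn1 PoszD addrA !zpowS IH mulrA.
by rewrite -addn1 PoszD opprD addrA !zpowP IH mulrA.
Qed.

End Zpow.

(** * The monomials [k^mu], their action on weight vectors, and the generator *)

Section CartanMonomials.
Context {R : realType} {n : nat} {U : algType R[i]}.
Local Notation C := R[i].
Variables (a : 'M[int]_n) (d : 'I_n -> int) (q : R).
Variables (e f k k' : 'I_n -> U).
Hypothesis hU : Uq_relations a d q e f k k'.
Implicit Types (mu nu lam : 'rV[int]_n).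

Lemma kmonD mu nu : kmon k k' (mu + nu) = kmon k k' mu * kmon k k' nu.
Proof.
have kk' := Uq_kk' hU; have k'k := Uq_k'k hU; have kC := Uq_kC hU.
rewrite /kmon prodrM_commute => [|i j].
  by apply: eq_bigr => i _; rewrite mxE zpowD.
by apply: comm_zpow => //; apply/commr_sym/comm_zpow => //; exact: kC.
Qed.

Lemma kmon0 : kmon k k' 0 = 1.
Proof. by rewrite /kmon big1// => i _; rewrite mxE. Qed.

Variables (star : U -> U) (Delta : U -> tensor U U) (eps : U -> C).
Hypothesis hbi : is_Uq_star_bialgebra e f k k' star Delta eps.

Lemma kmon_grouplike mu : Delta (kmon k k' mu) = kmon k k' mu ⊗ kmon k k' mu.
Proof.
have hB := Uq_star_bialgebra hbi.
rewrite /kmon; elim/big_ind: _ => [|x y|i _]; first exact: bialg_Delta1 hB.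
  exact: (grouplikeM hB).
case: (mu 0 i) => m /=; apply: (grouplikeX hB).
  exact: Uq_Delta_k hbi i.
exact: Uq_Delta_k' hbi i.
Qed.

Lemma eps_kmon mu : eps (kmon k k' mu) = 1.
Proof.
have [e1 eM] := bialg_epsM (Uq_star_bialgebra hbi).
rewrite /kmon; elim/big_ind: _ => [//|x y hx hy|i _].
  by rewrite eM hx hy mulr1.
have epsX x m : eps x = 1 -> eps (x ^+ m) = 1.
  by move=> hx; elim: m => [|m IH]//; rewrite exprS eM hx IH mulr1.
by case: (mu 0 i) => m /=; apply: epsX; rewrite (Uq_eps_k hbi, Uq_eps_k' hbi).
Qed.

(* [q^(<lam,mu>/2)], the eigenvalue of [k^mu] on the weight space of [lam] *)
Definition weight_char lam mu : R :=
  \prod_(i < n) (q `^ ((lam 0 i)%:~R / 2)) ^ mu 0 i.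

Variables (D : lmodType C) (ip : {dot D for @conjc R}) (rho : U -> D -> D).
Hypothesis hrho : is_unitary_rep star ip rho.
Hypothesis hq : 0 < q.

Lemma repZ u v (c : C) : rho u (c *: v) = c *: rho u v.
Proof.
have r0 w : rho w 0 = 0.
  have := rep_linear_op hrho w 1 0 0; rewrite !scale1r addr0.
  by move/eqP; rewrite -subr_eq0 opprD addNKr oppr_eq0 => /eqP.
by rewrite -[c *: v]addr0 (rep_linear_op hrho) r0 addr0.
Qed.

Lemma repX_eigen u m v (c : C) :
  rho u v = c *: v -> rho (u ^+ m) v = c ^+ m *: v.
Proof.
move=> huv; elim: m => [|m IH]; first by rewrite !expr0 (rep1 hrho) scale1r.
by rewrite exprSr (repM hrho) huv repZ IH scalerA exprS.
Qed.

Lemma rep_kmon lam mu v : weight_vector rho q k lam v ->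
  rho (kmon k k' mu) v = (weight_char lam mu)%:C *: v.
Proof.
move=> hv; rewrite /kmon /weight_char.
apply: (big_rec2 (fun (u : U) (z : R) => rho u v = z%:C *: v)).
  by rewrite (rep1 hrho) scale1r.
move=> i z u _ hu; rewrite (repM hrho) hu repZ rmorphM mulrC -scalerA.
congr (_ *: _); set c := q `^ _.
have c0 : c != 0 by rewrite gt_eqF// powR_gt0.
(* Negative exponents use [k' i], which acts by the inverse eigenvalue. *)
have k'v : rho (k' i) v = (c^-1)%:C *: v.
  rewrite -[in RHS](rep1 hrho v) -(Uq_k'k hU i) (repM hrho) hv repZ scalerA.
  by rewrite -rmorphM mulVf// scale1r.
case: (mu 0 i) => m /=.
  by rewrite (repX_eigen _ (hv i)) -rmorphXn.
by rewrite (repX_eigen _ k'v) -rmorphXn exprVn.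
Qed.

Hypothesis hqd : forall i, q ^ (2 * d i) != 1.

Lemma weight_vector_orthogonal lam lam' v v' : lam != lam' ->
  weight_vector rho q k lam v -> weight_vector rho q k lam' v' ->
  ip v v' = 0.
Proof.
move=> ll hv hv'.
have [i lli] : exists i, lam 0 i != lam' 0 i.
  apply/existsP; apply: contraR ll => /existsPn h; apply/eqP/rowP => i.
  by apply/eqP; have := h i; rewrite negbK.
have q1 : q != 1 by apply: contraNneq (hqd i) => ->; rewrite exp1rz.
(* The form is antilinear in this argument, but the eigenvalues are real. *)
have ZrE c : ip v (c%:C *: v') = c%:C * ip v v' by rewrite linearZr /= oppr0.
have := rep_unitary hrho (k i) v' v; rewrite (Uq_star_k hbi) hv hv' /braket.
rewrite linearZl_LR ZrE => /eqP.
rewrite -subr_eq0 -mulrBl -rmorphB mulf_eq0 => /orP[|/eqP//].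
(* Equal eigenvalues would mean equal multiples of [ln q], which is non-zero since [q != 1]. *)
rewrite fmorph_eq0 subr_eq0 /powR (gt_eqF hq) => /eqP/expR_inj/eqP.
rewrite (inj_eq (mulIf _)) ?ln_eq0// (inj_eq (mulIf _)) ?invr_eq0//.
by rewrite eqr_int eq_sym (negPf lli).
Qed.

Lemma dot_sqnorm v : ip v v = (sqnorm ip v)%:C.
Proof.
rewrite /sqnorm /braket; have : 0 <= ip v v by exact: dnorm_ge0.
by case: (ip v v) => x y; rewrite lecE /= => /andP[/eqP->].
Qed.

Lemma sqnorm_ge0 v : 0 <= sqnorm ip v.
Proof. by rewrite -lecR -dot_sqnorm; exact: dnorm_ge0. Qed.

Lemma generator_kmon (Omega : D) (Lam : {fset 'rV[int]_n})
    (v : 'rV[int]_n -> D) mu :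
  Omega = \sum_(lam <- Lam) v lam ->
  (forall lam, lam \in Lam -> weight_vector rho q k lam (v lam)) ->
  braket ip Omega (rho (kmon k k' mu) Omega - eps (kmon k k' mu) *: Omega) =
  (\sum_(lam <- Lam) sqnorm ip (v lam) * (weight_char lam mu - 1))%:C.
Proof.
move=> hOmega hv; rewrite eps_kmon scale1r.
have -> : rho (kmon k k' mu) Omega - Omega =
    \sum_(lam <- Lam) (weight_char lam mu - 1)%:C *: v lam.
  pose g : {linear D -> D} := HB.pack (rho (kmon k k' mu))
    (GRing.isLinear.Build _ _ _ _ _ (rep_linear_op hrho (kmon k k' mu))).
  rewrite hOmega -[rho _ _]/(g _) linear_sum -sumrB big_seq [RHS]big_seq.
  apply: eq_bigr => lam lamL; rewrite /= (rep_kmon _ (hv _ lamL)).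
  by rewrite rmorphB scalerBl scale1r.
rewrite /braket linear_sumlz rmorph_sum /= big_seq [RHS]big_seq.
apply: eq_bigr => lam lamL; rewrite linearZl_LR /= mulrC rmorphM; congr (_ * _).
(* Only the diagonal term survives, by orthogonality of the weight spaces. *)
rewrite hOmega linear_sumr (bigD1_seq lam) ?fset_uniq//= dot_sqnorm big1_seq.
  by rewrite addr0.
move=> lam' /andP[ll lamL'].
by apply: weight_vector_orthogonal (hv _ lamL) (hv _ lamL'); rewrite eq_sym.
Qed.

Lemma generator_scalar (Omega : D) :
  scalar (fun u => braket ip Omega (rho u Omega - eps u *: Omega)).
Proof.
move=> c u u' /=.
rewrite (rep_linear hrho) (bialg_eps_linear (Uq_star_bialgebra hbi)).
rewrite scalerDl opprD addrACA -scalerA -scalerBr /braket linearDl.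
by rewrite linearZl_LR.
Qed.

End CartanMonomials.

(** * Integrals of products of independent variables with values in [nat] *)

Section NatValued.
Context {R : realType} {disp : measure_display} {T : measurableType disp}.
Variable P : probability T R.
Local Open Scope ereal_scope.

Lemma measurable_nat_comp (Y : T -> nat) (f : nat -> R) (D : set T) :
  measurable_fun setT Y -> measurable_fun D (fun w => f (Y w)).
Proof.
move=> mY; apply: measurable_funTS.
by apply: (@measurableT_comp _ _ _ _ _ _ f) mY.
Qed.

Lemma measurable_nat_preimage (Y : T -> nat) (A : set nat) :
  measurable_fun setT Y -> measurable (Y @^-1` A).
Proof. by move=> mY; rewrite -[X in measurable X]setTI; exact: mY. Qed.

(* Integrating over an arbitrary event [D] lets the induction condition on the
   value of one variable at a time. *)
Lemma integral_prod_indep (I : choiceType) (r : seq I) (Y : I -> T -> nat)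
    (f : I -> nat -> R) (c : I -> R) (D : set T) :
  uniq r -> measurable D ->
  (forall i, i \in r -> measurable_fun setT (Y i)) ->
  (forall i x, (0 <= f i x)%R) ->
  (forall i, i \in r ->
     \sum_(x <oo) (f i x)%:E * P (Y i @^-1` [set x]) = (c i)%:E) ->
  (forall A : I -> set nat,
     P (D `&` \bigcap_(i in [set` r]) Y i @^-1` A i) =
     P D * \prod_(i <- r) P (Y i @^-1` A i)) ->
  \int[P]_(w in D) (\prod_(i <- r) f i (Y i w))%:E =
  P D * (\prod_(i <- r) c i)%:E.
Proof.
elim: r D => [|i r IH] D /= => [_ mD _ _ _ _|].
  under eq_integral do rewrite big_nil.
  by rewrite integral_cst// big_nil muleC.
case/andP=> ir ur mD mY f0 hc hP.
have mYi : measurable_fun setT (Y i) by apply: mY; rewrite mem_head.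
have mYr k : k \in r -> measurable_fun setT (Y k).
  by move=> kr; apply: mY; rewrite in_cons kr orbT.
have mF x : measurable (D `&` Y i @^-1` [set x]).
  by apply: measurableI => //; exact: measurable_nat_preimage.
have capE (F : I -> set T) : (\bigcap_(k in [set` i :: r]) F k =
    F i `&` \bigcap_(k in [set` r]) F k)%classic by rewrite !bigcap_seq big_cons.
have hPx x (A : I -> set nat) :
    P (D `&` Y i @^-1` [set x] `&` \bigcap_(k in [set` r]) Y k @^-1` A k) =
    P D * (P (Y i @^-1` [set x]) * \prod_(k <- r) P (Y k @^-1` A k)).
  (* The event for the head variable is fixed to the singleton of [x], the others stay arbitrary. *)
  have := hP (fun k => if k == i then [set x]%classic else A k).
  rewrite capE big_cons eqxx setIA.
  have kiE k : k \in r -> (k == i) = false.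
    by move=> kr; apply: contraNF ir => /eqP<-.
  rewrite (@eq_bigcapr _ _ _ _ (fun k => Y k @^-1` A k)); last first.
    by move=> k /= kr; rewrite kiE.
  move=> ->; congr (_ * (_ * _)); rewrite big_seq [RHS]big_seq.
  by apply: eq_bigr => k kr; rewrite kiE.
have PDx x : P (D `&` Y i @^-1` [set x]) = P D * P (Y i @^-1` [set x]).
  (* Full events for the tail give independence of [D] and the head variable. *)
  have := hPx x (fun=> setT).
  rewrite (_ : (\bigcap_(k in _) _)%classic = setT); last exact/seteqP.
  rewrite setIT => ->.
  by rewrite big1 ?mule1// => k _; rewrite preimage_setT probability_setT.
have DE : D = (\bigcup_x (D `&` Y i @^-1` [set x]))%classic.
  apply/seteqP; split=> [w Dw|w [x _ []//]]; by exists (Y i w).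
have mG (E : set T) :
    measurable_fun E (fun w => (\prod_(k <- r) f k (Y k w))%R).
  apply: measurable_prod => k kr; exact: measurable_nat_comp (mYr _ kr).
have G0 w : (0 <= \prod_(k <- r) f k (Y k w))%R by apply: prodr_ge0.
rewrite {1}DE ge0_integral_bigcup//=; last first.
- by apply: trivIset_setIl; exact: trivIset_preimage1.
- by move=> w _; rewrite lee_fin; apply: prodr_ge0.
- apply/measurable_EFinP; apply: measurable_prod => k kr.
  exact: measurable_nat_comp (mY _ kr).
(* On the piece where the head variable equals [x] its factor is the constant [f i x]; the induction
   hypothesis, applied with this piece in place of [D], integrates the rest. *)
transitivity (\sum_(x <oo)
    (fine (P D) * \prod_(k <- r) c k)%:E *
    ((f i x)%:E * P (Y i @^-1` [set x]))).
  apply: eq_eseriesr => x _.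
  transitivity (\int[P]_(w in D `&` Y i @^-1` [set x])
      ((f i x)%:E * (\prod_(k <- r) f k (Y k w))%:E)).
    apply: eq_integral => w; rewrite inE => -[_ /= <-].
    by rewrite big_cons EFinM.
  rewrite ge0_integralZl_EFin//; first last.
  - exact/measurable_EFinP.
  - by move=> w _; rewrite lee_fin.
  rewrite IH// => [|k kr|A]; last 2 first.
  - by apply: hc; rewrite in_cons kr orbT.
  - by rewrite hPx PDx muleA.
  rewrite PDx EFinM fineK ?fin_num_measure// -!muleA [LHS]muleCA; congr (_ * _).
  by rewrite muleA muleC.
rewrite nneseriesZl; last by move=> x _; rewrite mule_ge0 ?lee_fin.
rewrite hc ?mem_head// EFinM fineK ?fin_num_measure// -muleA -EFinM.
by rewrite big_cons mulrC.
Qed.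

End NatValued.

(** * The Poisson generating function *)

Section PoissonDistribution.
Context {R : realType}.
Local Open Scope ereal_scope.

Lemma poisson_prob_set1 (rate : R) (x : nat) : (0 <= rate)%R ->
  poisson_prob rate 0 [set x] = (rate ^+ x / x`!%:R * expR (- rate))%:E.
Proof.
rewrite le_eqVlt => /predU1P[<-|rate0]; rewrite /poisson_prob.
  (* At rate 0 the Dirac mass agrees with the formula because [0 ^+ 0 = 1]. *)
  rewrite ltxx diracE expr0n oppr0 expR0 mulr1.
  case: x => [|x]; first by rewrite mem_set// divr1.
  by rewrite memNset// mul0r.
rewrite rate0 esum_set1 /poisson_pmf rate0// lee_fin mulr_ge0 ?expR_ge0//.
by rewrite divr_ge0// exprn_ge0// ltW.
Qed.

(** Once [expR (- rate)] is factored out, the exponential series at [rate * z] remains. *)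
Lemma poisson_generating_function (rate z : R) : (0 <= rate)%R -> (0 <= z)%R ->
  \sum_(x <oo) (z ^+ x)%:E * poisson_prob rate 0 [set x] =
  (expR (rate * (z - 1)))%:E.
Proof.
move=> rate0 z0.
transitivity (\sum_(x <oo) (expR (- rate))%:E * (exp_coeff (rate * z) x)%:E).
  apply: eq_eseriesr => x _; rewrite poisson_prob_set1// -!EFinM; congr (_%:E).
  rewrite /exp_coeff /= exprMn mulrA mulrC; congr (_ * _)%R.
  by rewrite mulrA (mulrC (z ^+ x)%R).
rewrite nneseriesZl; last first.
  by move=> x _; rewrite lee_fin divr_ge0// exprn_ge0// mulr_ge0.
rewrite mulrBr mulr1 addrC expRD EFinM; congr (_ * _).
rewrite [in RHS]/expR -EFin_lim; last exact: is_cvg_series_exp_coeff.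
by apply/congr_lim/funext => m /=; rewrite /series /= -sumEFin.
Qed.

End PoissonDistribution.

(** * Increments of independent Poisson processes over the grid *)

Section PoissonFamily.
Context {R : realType} {disp : measure_display} {T : measurableType disp}.
Variables (P : probability T R) (I : choiceType) (Lam : {fset I}).
Variable Np : I -> R -> T -> nat.
Hypothesis hNp : forall lam, lam \in Lam -> is_poisson_process P (Np lam).
Hypothesis hind : independent_processes P [set` Lam] Np.
Variables (c : I -> R) (tau : nat -> R) (M : nat).
Hypothesis c0 : forall lam, 0 <= c lam.
Hypothesis tau0 : forall p, 0 <= tau p.
Hypothesis tau_nd : forall p r, (p <= r)%N -> tau p <= tau r.

Let cells := [fset p in iota 0 M]%fset.

(** Process and cell form a single index, so that [integral_prod_indep] treats the whole family at
    once. *)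
Definition poisson_incr (x : I * nat) (w : T) : nat :=
  (Np x.1 (c x.1 * tau x.2.+1) w - Np x.1 (c x.1 * tau x.2) w)%N.

Let ctau0 lam p : 0 <= c lam * tau p. Proof. exact: mulr_ge0. Qed.

(** The generated sigma-algebra is taken as a measurable space of its own, in which every [Np lam t]
    with [0 <= t] is measurable. This makes independence of the processes applicable to events about
    increments. *)
Lemma sigma_process_incr lam (A : nat -> set nat) :
  sigma_process (Np lam)
    (\bigcap_(p in [set` cells]) poisson_incr (lam, p) @^-1` A p)%classic.
Proof.
rewrite /sigma_process; set G := (\bigcup_(t in _) _)%classic.
have mN t : 0 <= t ->
    measurable_fun [set: g_sigma_algebraType G] (Np lam t).
  by move=> t0 _ B _; apply: sub_sigma_algebra; exists t => //; exists B.
change (measurable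
  ((\bigcap_(p in [set` cells]) poisson_incr (lam, p) @^-1` A p)%classic :
    set (g_sigma_algebraType G))).
apply: bigcap_measurableType => p _.
apply: (@measurable_nat_preimage _ (g_sigma_algebraType G)).
by apply: measurable_fun_subn; exact: mN.
Qed.

(** Two layers of independence are combined: first between the processes, then between the
    increments of each one at the times [c lam * tau p]. *)
Lemma poisson_incr_indep (A : I * nat -> set nat) :
  let r := [seq (lam, p) | lam <- Lam, p <- cells] in
  P (\bigcap_(x in [set` r]) poisson_incr x @^-1` A x)%classic =
  (\prod_(x <- r) P (poisson_incr x @^-1` A x))%E.
Proof.
move=> r; rewrite big_allpairs.
have -> : (\bigcap_(x in [set` r]) poisson_incr x @^-1` A x =
    \bigcap_(lam in [set` Lam]) \bigcap_(p in [set` cells])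
      poisson_incr (lam, p) @^-1` A (lam, p))%classic.
  apply/seteqP; split=> w h.
    by move=> lam lamL p pM; apply: h; apply: allpairs_f.
  by move=> x /= /allpairsP[[lam p] /= [lamL pM ->]]; apply: h.
pose F lam : set T :=
  (\bigcap_(p in [set` cells]) poisson_incr (lam, p) @^-1` A (lam, p))%classic.
rewrite (@hind Lam F)//; last first.
  by move=> lam _; apply: (@sigma_process_incr lam (fun p => A (lam, p))).
rewrite big_seq [RHS]big_seq; apply: eq_bigr => lam lamL.
have /(_ (fun p => c lam * tau p)) h := poisson_indep_increments (hNp lamL).
rewrite (h _ _ cells)// => [l|l _].
  by rewrite ler_wpM2l// tau_nd.
by exists (A (lam, l)) => //; rewrite setTI.
Qed.

Lemma integral_poisson_incr (z : I * nat -> R) : (forall x, 0 <= z x) ->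
  (\int[P]_w (\prod_(lam <- Lam) \prod_(p < M)
     z (lam, val p) ^+ poisson_incr (lam, val p) w)%:E)%E =
  (\prod_(lam <- Lam) \prod_(p < M)
     expR (c lam * (tau p.+1 - tau p) * (z (lam, val p) - 1)))%:E.
Proof.
move=> z0.
have cellsE (F : nat -> R) : \prod_(p <- cells) F p = \prod_(p < M) F p.
  rewrite -(big_mkord xpredT) /index_iota subn0; apply: perm_big.
  apply: uniq_perm; rewrite ?fset_uniq ?iota_uniq// => p.
  by rewrite !inE.
set r := [seq (lam, p) | lam <- Lam, p <- cells].
pose g (x : I * nat) := expR (c x.1 * (tau x.2.+1 - tau x.2) * (z x - 1)).
have -> : \prod_(lam <- Lam) \prod_(p < M) g (lam, val p) = \prod_(x <- r) g x.
  by rewrite big_allpairs; apply: eq_bigr => lam _; rewrite cellsE.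
under eq_integral => w _.
  rewrite (_ : \prod_(lam <- Lam) _ = \prod_(x <- r) z x ^+ poisson_incr x w).
    over.
  by rewrite big_allpairs; apply: eq_bigr => lam _; rewrite cellsE.
rewrite (@integral_prod_indep _ _ _ _ _ r poisson_incr
  (fun x m => z x ^+ m) g)//.
- by rewrite probability_setT mul1e.
- by apply: allpairs_uniq; rewrite ?fset_uniq// => -[? ?] [? ?].
- move=> x /allpairsP[[lam p] /= [lamL pM ->]].
  have mN := poisson_measurable (hNp lamL).
  by apply: measurable_fun_subn; exact: mN.
- by move=> x m; apply: exprn_ge0.
- move=> x /allpairsP[[lam p] /= [lamL pM ->]].
  have ct : 0 <= c lam * tau p <= c lam * tau p.+1.
    by rewrite ctau0 ler_wpM2l// tau_nd.
  rewrite (eq_eseriesr (g := fun m => (z (lam, p) ^+ m)%:E *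
      poisson_prob (c lam * tau p.+1 - c lam * tau p) 0 [set m])%E); last first.
    move=> m _; congr (_ * _)%E.
    exact: (poisson_increments (hNp lamL) ct [set m]).
  rewrite poisson_generating_function// ?subr_ge0; last by case/andP: ct.
  by rewrite /g /= (mulrBr (c lam)).
- by move=> A; rewrite setTI probability_setT mul1e poisson_incr_indep.
Qed.

End PoissonFamily.

(** * The classical monomials in terms of the Poisson processes *)

Section KhatMonomials.
Context {R : realType} {n : nat} {disp : measure_display}.
Context {T : measurableType disp}.
Variables (q : R) (Lam : {fset 'rV[int]_n}) (c : 'rV[int]_n -> R).
Variable Np : 'rV[int]_n -> R -> T -> nat.
Hypothesis hq : 0 < q.
Local Notation N := (jump_process Lam c Np).
Implicit Types lam mu nu : 'rV[int]_n.

Lemma weight_char_gt0 lam mu : 0 < weight_char q lam mu :> R.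
Proof. by apply: prodr_gt0 => i _; rewrite exprz_gt0// powR_gt0. Qed.

Lemma weight_char0 lam : weight_char q lam 0 = 1 :> R.
Proof. by apply: big1 => i _; rewrite mxE expr0z. Qed.

Lemma weight_charD lam mu nu :
  weight_char q lam (mu + nu) = weight_char q lam mu * weight_char q lam nu.
Proof.
rewrite /weight_char -big_split; apply: eq_bigr => i _.
by rewrite mxE expfzDr// gt_eqF// powR_gt0.
Qed.

(** This is [q^(<N_t,mu>/2)], with the factors grouped by jump vector instead of by coordinate. *)
Definition jump_weight mu t w : R :=
  \prod_(lam <- Lam) weight_char q lam mu ^+ Np lam (c lam * t) w.

Lemma jump_weight_gt0 mu t w : 0 < jump_weight mu t w.
Proof. by apply: prodr_gt0 => lam _; rewrite exprn_gt0// weight_char_gt0. Qed.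

(** The map [x] to [q^(x/2)] turns sums into products, and the products over coordinates and over
    jump vectors are exchanged. Differences are taken in the lattice, so the identity holds at every
    [w]. *)
Lemma khat_monE mu s t w :
  khat_mon q N mu s t w = jump_weight mu t w / jump_weight mu s w.
Proof.
pose h (x : int) : R := q `^ (x%:~R / 2).
have h0 : h 0 = 1 by rewrite /h mul0r powRr0.
have hD : {morph h : x y / x + y >-> x * y}.
  by move=> x y; rewrite /h intrD mulrDl powRD// (gt_eqF hq) implybT.
have hpos x : 0 < h x by exact: powR_gt0.
have hMn x m : h (x *+ m) = h x ^+ m.
  by elim: m => [|m IH]; rewrite ?mulr0n ?expr0// mulrS exprS hD IH.
have hN u i : h (N u w 0 i) =
    \prod_(lam <- Lam) h (lam 0 i) ^+ Np lam (c lam * u) w.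
  rewrite /jump_process summxE (big_morph h hD h0).
  by apply: eq_bigr => lam _; rewrite mulmxnE hMn.
have khatE i : khat q N i s t w = h (N t w 0 i) / h (N s w 0 i).
  apply: (mulIf (lt0r_neq0 (hpos (N s w 0 i)))).
  by rewrite divfK ?lt0r_neq0// -hD subrK.
have powN u : \prod_(i < n) h (N u w 0 i) ^ mu 0 i = jump_weight mu u w.
  rewrite /jump_weight /weight_char.
  under [RHS]eq_bigr do rewrite -prodrXl.
  rewrite exchange_big /=; apply: eq_bigr => i _; rewrite hN.
  rewrite (big_morph (fun x : R => x ^ mu 0 i) (fun x y => expfzMl x y _)
    (exp1rz _ _)).
  by apply: eq_bigr => lam _; rewrite exprnP exprzAC.
rewrite -!powN -prodf_div /khat_mon; apply: eq_bigr => i _.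
by rewrite khatE expfzMl exprz_inv invr_expz.
Qed.

End KhatMonomials.

(** * Levy increments at group-like elements *)

Section LevyGrouplike.
Context {R : realType} {B A : algType R[i]}.
Variables (starB : B -> B) (Delta : B -> tensor B B) (eps : B -> R[i]).
Variables (starA : A -> A) (Phi : A -> R[i]) (j : R -> R -> B -> A).
Hypothesis hj : is_levy_process starB Delta eps starA Phi j.

Lemma levy_increment_grouplike s t u b : 0 <= s <= t -> t <= u ->
  Delta b = b ⊗ b -> j s u b = j s t b * j t u b.
Proof.
move=> st tu hb; have /andP[s0 st'] := st.
have tu' : 0 <= t <= u by rewrite tu (le_trans s0 st').
rewrite -(levy_increment hj _ st tu) hb tens_liftE//.
have lst := star_hom_linear (levy_star_hom hj st).
have ltu := star_hom_linear (levy_star_hom hj tu').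
split=> [x c y y'|y c x x'].
  by rewrite ltu mulrDr scalerAr.
by rewrite lst mulrDl scalerAl.
Qed.

End LevyGrouplike.

(** * Comparison of quantum and classical joint moments *)

Theorem theorem5p1 (R : realType) (n : nat)
  (* a complex simple Lie algebra with Cartan matrix a *)
  (L : vectType R[i]) (br : L -> L -> L) (hL : simple_lie_algebra br)
  (a : 'M[int]_n) (ha : is_cartan_matrix br a)
  (d : 'I_n -> int) (hd : symmetrizes a d)
  (q : R) (hq : 0 < q) (hqd : forall i, q ^ (2 * d i) != 1)
  (* the *-bialgebra U_q(g_c) *)
  (U : algType R[i]) (e f k k' : 'I_n -> U) (hU : is_Uq a d q e f k k')
  (starU : U -> U) (Delta : U -> tensor U U) (eps : U -> R[i])
  (hbi : is_Uq_star_bialgebra e f k k' starU Delta eps)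
  (* a unitary representation on a pre-Hilbert space *)
  (D : lmodType R[i]) (ip : {dot D for @conjc R}) (rho : U -> D -> D)
  (hrho : is_unitary_rep starU ip rho)
  (hirr : orthogonal_sum_of_irreducibles ip rho)
  (hwt : sum_of_weight_spaces rho q k)
  (Omega : D)
  (* a Levy process with the given generator *)
  (A : algType R[i]) (starA : A -> A) (hA : is_involution starA)
  (Phi : A -> R[i]) (hPhi : is_state starA Phi)
  (j : R -> R -> U -> A)
  (hj : is_levy_process starU Delta eps starA Phi j)
  (hpsi : is_generator Delta eps Phi j
     (fun u => braket ip Omega (rho u Omega - eps u *: Omega)))
  (* the weight decomposition of Omega *)
  (Lam : {fset 'rV[int]_n}) (v : 'rV[int]_n -> D)
  (hOmega : Omega = \sum_(lam <- Lam) v lam)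
  (hv : forall lam, lam \in Lam -> weight_vector rho q k lam (v lam))
  (* independent Poisson processes *)
  (disp : measure_display) (T : measurableType disp) (P : probability T R)
  (Np : 'rV[int]_n -> R -> T -> nat)
  (hNp : forall lam, lam \in Lam -> is_poisson_process P (Np lam))
  (hind : independent_processes P [set` Lam] Np) :
  let N := jump_process Lam (fun lam => sqnorm ip (v lam)) Np in
  forall (m : nat) (mu : 'I_m -> 'rV[int]_n) (s t : 'I_m -> R),
    (forall l, 0 <= s l <= t l) ->
    let X := fun w : T => \prod_(l < m) khat_mon q N (mu l) (s l) (t l) w in
    P.-integrable [set: T] (EFin \o X) /\
    Phi (\prod_(l < m) j (s l) (t l) (kmon k k' (mu l))) = (fine 'E_P[X])%:C.
Proof.
move=> N m mu s t st X.
pose c lam := sqnorm ip (v lam).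
have c0 lam : 0 <= c lam by exact: sqnorm_ge0.
have hB := Uq_star_bialgebra hbi.
have [tau [M [a' [b' [tau0 tau_nd sE tE abM]]]]] := sorted_grid st.
(* The total exponent carried by cell [p], summed over the intervals covering it. *)
pose nu p := \sum_(l < m) if (a' l <= p < b' l)%N then mu l else 0.
have tau_itv p r : (p <= r)%N -> 0 <= tau p <= tau r.
  by move=> pr; rewrite tau0 tau_nd.
have j_refine : \prod_(l < m) j (s l) (t l) (kmon k k' (mu l)) =
    \prod_(p < M) j (tau p) (tau p.+1) (kmon k k' (nu p)).
  pose h p r x := j (tau p) (tau r) (kmon k k' x).
  under eq_bigr do rewrite -sE -tE.
  rewrite -(big_mkord xpredT (fun p => h p p.+1 (nu p))).
  apply: (refine_increments (h := h)) => //
    [p x|p r pr|p r x y pr|p r u x pru|p r u w x y pr ruw].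
  - by rewrite /h (levy_start hj)// (eps_kmon hbi) scale1r.
  - by rewrite /h (kmon0 _ _) (star_homM (levy_star_hom hj (tau_itv _ _ pr))).1.
  - rewrite /h (kmonD (Uq_rel hU)).
    by rewrite (star_homM (levy_star_hom hj (tau_itv _ _ pr))).2.
  - have /andP[pr ru] := pru.
    by apply: (levy_increment_grouplike hj);
      rewrite ?tau_itv ?tau_nd ?(kmon_grouplike hbi).
  - have /andP[ru uw] := ruw; apply/esym/(levy_commute hj); rewrite ?tau_itv//.
    by rewrite !tau_nd.
have X_refine w : X w = \prod_(p < M) khat_mon q N (nu p) (tau p) (tau p.+1) w.
  pose h p r x := khat_mon q N x (tau p) (tau r) w.
  have jw0 x u : jump_weight q Lam c Np x u w != 0.
    by rewrite gt_eqF// jump_weight_gt0.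
  have hE p r x : h p r x = jump_weight q Lam c Np x (tau r) w /
                            jump_weight q Lam c Np x (tau p) w.
    by rewrite /h khat_monE.
  rewrite /X; under eq_bigr do rewrite -sE -tE.
  rewrite -(big_mkord xpredT (fun p => h p p.+1 (nu p))).
  apply: (refine_increments (h := h)) => //
    [p x|p r pr|p r x y pr|p r u x pru|p r u z x y pr ruw].
  - by rewrite hE divff.
  - rewrite hE /jump_weight !big1 ?divr1// => lam _;
      by rewrite weight_char0 expr1n.
  - have jwD u : jump_weight q Lam c Np (x + y) u w =
        jump_weight q Lam c Np x u w * jump_weight q Lam c Np y u w.
      rewrite /jump_weight -big_split; apply: eq_bigr => lam _ /=.
      by rewrite weight_charD// exprMn.
    by rewrite !hE !jwD invfM mulrACA.
  - by rewrite !hE [RHS]mulrC mulrA divfK.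
  - exact: mulrC.
pose z x := weight_char q x.1 (nu x.2).
(* Only almost sure: the truncated difference in [poisson_incr] is the true increment along
   nondecreasing paths. *)
have Y_ae : {ae P, forall w, X w = \prod_(lam <- Lam) \prod_(p < M)
     z (lam, val p) ^+ poisson_incr Np c tau (lam, val p) w}.
  have nd : {ae P, forall w, (\bigcap_(lam in [set` Lam]) [set w | forall u u',
      0 <= u <= u' -> (Np lam u w <= Np lam u' w)%N])%classic w}.
    apply: filter_bigI => lam lamL; have := poisson_paths (hNp _ lamL).
    by apply: filterS => w [].
  apply: filterS nd => w hw; rewrite X_refine [RHS]exchange_big /=.
  apply: eq_bigr => p _; rewrite khat_monE// /jump_weight -prodf_div.
  rewrite big_seq [RHS]big_seq; apply: eq_bigr => lam lamL.
  rewrite /poisson_incr /= exprB ?unitfE ?gt_eqF ?weight_char_gt0//.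
  by apply: (hw lam) => //; rewrite mulr_ge0//= ler_wpM2l// tau_nd.
(* An almost sure identity does not transfer measurability, so the pointwise formula [khat_monE] is
   used. *)
have mX : measurable_fun setT X.
  rewrite (_ : X = fun w => \prod_(p < M)
      (jump_weight q Lam c Np (nu p) (tau p.+1) w /
       jump_weight q Lam c Np (nu p) (tau p) w)); last first.
    apply/funext => w; rewrite X_refine.
    by apply: eq_bigr => p _; rewrite khat_monE.
  have mN lam u : lam \in Lam -> 0 <= u ->
      measurable_fun setT (Np lam (c lam * u)).
    by move=> lamL u0; apply: (poisson_measurable (hNp _ lamL)); rewrite mulr_ge0.
  apply: measurable_prod => p _; under eq_fun do rewrite -prodf_div.
  apply: measurable_prod => lam lamL; apply: measurable_funM.
    exact: (measurable_nat_comp (fun i => weight_char q lam (nu p) ^+ i))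
      (mN _ _ lamL (tau0 _)).
  exact: (measurable_nat_comp (fun i => weight_char q lam (nu p) ^- i))
    (mN _ _ lamL (tau0 _)).
have X0 w : 0 <= X w.
  rewrite X_refine prodr_ge0// => p _.
  by rewrite khat_monE// divr_ge0// ltW ?jump_weight_gt0.
have intX : (\int[P]_w (X w)%:E)%E = (\prod_(lam <- Lam) \prod_(p < M)
     expR (c lam * (tau p.+1 - tau p) * (z (lam, val p) - 1)))%:E.
  have z0 x : 0 <= z x by rewrite ltW ?weight_char_gt0.
  rewrite -(integral_poisson_incr hNp hind M c0 tau0 tau_nd z0).
  apply: ge0_ae_eq_integral => //.
  - exact/measurable_EFinP.
  - apply/measurable_EFinP; apply: measurable_prod => lam lamL.
    apply: measurable_prod => p _.
    apply: (measurable_nat_comp (fun i => z (lam, val p) ^+ i)).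
    have mN := poisson_measurable (hNp _ lamL).
    by apply: measurable_fun_subn; apply: mN; rewrite mulr_ge0.
  - by move=> w _; rewrite lee_fin.
  - move=> w _; rewrite lee_fin prodr_ge0// => lam _; rewrite prodr_ge0// => p _.
    by rewrite exprn_ge0.
  - by apply: filterS Y_ae => w + _ => ->.
split.
  apply/integrableP; split; first exact/measurable_EFinP.
  under eq_integral do rewrite /= ger0_norm//.
  by rewrite intX ltry.
have -> : ('E_P[X] = \int[P]_w (X w)%:E)%E by rewrite unlock.
(* Both sides are now products over cells: on the quantum side by independence of [j] over
   successive cells. *)
rewrite intX /= j_refine (levy_independent hj); first last.
- by move=> p p' pp'; rewrite tau_nd.
- by move=> p; rewrite tau_itv.
rewrite [X in X%:C]exchange_big /= rmorph_prod; apply: eq_bigr => p _.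
rewrite (convolution_exp_grouplike hB (generator_scalar hbi hrho _)
  (kmon_grouplike hbi (nu p)) (eps_kmon hbi _)
  (generator_kmon hU.(Uq_rel) hbi hrho hq hqd (nu p) hOmega hv)
  (hpsi _ _ _ (tau_itv _ _ (leqnSn p)))).
(* In one cell, the exponential of the sum over weights splits into the Poisson factors. *)
congr (_%:C); rewrite mulr_sumr (big_morph _ (@expRD R) (expR0 R)).
by apply: eq_bigr => lam _; rewrite mulrA (mulrC (_ - _)).
Qed.
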